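(* Let $\lambda$ and $\mu$ be partitions. Then $$\Delta\left(\mathrm{BD}^{\lambda\,\varnothing}\cdot \mathrm{BD}^{\varnothing\,\mu}\right)=\mathrm{BD}^{\lambda\,\mu}\qquad\text{and}\qquad \mathbf{\Delta}\left(\mathbf{BD}^{\lambda\,\varnothing}\cdot \mathbf{BD}^{\varnothing\,\mu}\right)=\mathbf{BD}^{\lambda\,\mu}.$$
   Context: A partition is a finite weakly decreasing sequence of non-negative integers; $|\lambda|$ is the sum of its parts and $\varnothing$ is the trivial partition (of $0$). For a partition $\lambda$ of $m$, $\chi^\lambda$ is the irreducible character of the symmetric group $S_m$ indexed by $\lambda$ (in the standard way). For a permutation $\pi$ and $k\ge 1$, $\pi(k)$ denotes the number of $k$-cycles of $\pi$ (not the image of $k$). Let $p_1,p_2,\dots,\tilde p_1,\tilde p_2,\dots$ be independent commuting variables and $V=\mathbb{Q}[[p_1,p_2,\dots,\tilde p_1,\tilde p_2,\dots]]$. For $\lambda$ a partition of $m$ and $\mu$ a partition of $p$, the polynomial $\mathrm{BD}^{\lambda\,\mu}\in V$ is $$\mathrm{BD}^{\lambda\,\mu}=\frac1{m!}\sum_{\pi\in S_m}\frac1{p!}\sum_{\rho\in S_p}\chi^\lambda(\pi)\chi^\mu(\rho)\prod_{k>0}F_k(\pi,\rho),$$ where $$F_k(\pi,\rho)=\begin{cases}k^{\rho(k)}\rho(k)!\,L^{(\pi(k)-\rho(k))}_{\rho(k)}\left(-\frac{p_k\tilde p_k}{k}\right)p_k^{\pi(k)-\rho(k)}&\text{if }\pi(k)\ge\rho(k),\\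 k^{\pi(k)}\pi(k)!\,L^{(\rho(k)-\pi(k))}_{\pi(k)}\left(-\frac{p_k\tilde p_k}{k}\right)\tilde p_k^{\rho(k)-\pi(k)}&\text{if }\rho(k)\ge\pi(k),\end{cases}$$ and $L_n^{(\alpha)}(t)=\sum_{k=0}^n\binom{n+\alpha}{n-k}\frac{(-t)^k}{k!}$ is the Laguerre polynomial. Let $\mathbf{\Lambda}(\overline X)$, $\mathbf{\Lambda}(\overline Y)$ be the algebras of symmetric functions over $\mathbb{Q}$ in the countable variable sets $\overline X=\{x_1,x_2,\dots\}$ and $\overline Y=\{y_1,y_2,\dots\}$, let $\mathbf{p}_k$ and $\tilde{\mathbf{p}}_k$ be the respective power sums, and let $\mathbf{\Lambda}(\overline X,\overline Y)=\mathbf{\Lambda}(\overline X)\otimes_{\mathbb{Q}}\mathbf{\Lambda}(\overline Y)$, which is the polynomial algebra over $\mathbb{Q}$ in the $\mathbf{p}_k,\tilde{\mathbf{p}}_k$, $k\ge1$. The element $\mathbf{BD}^{\lambda\,\mu}\in\mathbf{\Lambda}(\overline X,\overline Y)$ is defined by the same formulas as $\mathrm{BD}^{\lambda\,\mu}$ with $p_k,\tilde p_k$ replaced by $\mathbf{p}_k,\tilde{\mathbf{p}}_k$. The operator $\Delta$ is $$\Delta=\exp\left(\sum_{k>0}k\,\partial_{p_k}\partial_{\tilde p_k}\right)=\prod_{k>0}\sum_{i\ge0}\frac{k^i}{i!}(\partial_{p_k}\partial_{\tilde p_k})^i,$$ where powers denote composition; on a polynomial in the $p_k,\tilde p_k$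 only finitely many terms contribute. The operator $\mathbf{\Delta}$ on $\mathbf{\Lambda}(\overline X,\overline Y)$ is defined by the same formula with $\partial_{p_k},\partial_{\tilde p_k}$ replaced by $\partial_{\mathbf{p}_k},\partial_{\tilde{\mathbf{p}}_k}$. *)

(* Defs.v *)
From HB Require Import structures.
From mathcomp Require Import all_boot all_order all_fingroup all_algebra.
From mathcomp Require Import mxrepresentation.
From mathcomp Require Import finmap monalg.
From mathcomp Require Import boolp classical_sets.

Set Implicit Arguments.
Unset Strict Implicit.
Unset Printing Implicit Defensive.

Import GRing.Theory.
Local Open Scope ring_scope.

Local Notation "1" := (@mone _) : monom_scope.
Local Notation "x * y" := (mmul x y) : monom_scope.

Section Monomials.
Context (I : choiceType).
Implicit Types (m a b : {cmonom I}).

(* The finite set of divisors of the monomial m. *)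
Definition mdivs m : {fset {cmonom I}} :=
  [fset a in [fset [cmonom (F i : nat) | i : finsupp m]%M
               | F : {ffun finsupp m -> 'I_(mdeg m).+1} in predT]
   | (a * divcm m a == m)%M]%fset.

Lemma divcmK m a b : (a * b)%M = m -> divcm m a = b.
Proof. by move=> <-; apply/eqP/cmP => i; rewrite divcmE cmM addKn. Qed.

Lemma mem_mdivs m a : (a \in mdivs m) = (a * divcm m a == m)%M.
Proof.
rewrite !inE /=; apply: andb_idl => /eqP e.
have le i : (a i <= m i)%N by rewrite -e cmM leq_addr.
have lem i : (m i <= mdeg m)%N.
  rewrite mdegE; have [im|] := boolP (i \in finsupp m).
    by rewrite (big_fsetD1 i im) leq_addr.
  by rewrite -cmE_eq0 => /eqP->.
apply/imfsetP; exists [ffun i => inord (a (val i))] => //.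
apply/eqP/cmP => i; rewrite cmE fsfun_ffun.
case: insubP => [u _ <-|]; rewrite /= ?ffunE.
  by rewrite inordK // ltnS (leq_trans (le _)).
by rewrite -cmE_eq0 => /eqP e0; move: (le i); rewrite e0 leqn0 => /eqP.
Qed.
End Monomials.

(* Formal power series over R in the commuting variables X_i, i : I, where I may
   be infinite: f m is the coefficient of the monomial m. *)
Definition fps (I : choiceType) (R : comNzRingType) := {cmonom I} -> R.

Section FPS.
Context (I : choiceType) (R : comNzRingType).
Implicit Types (m a b : {cmonom I}) (f g h : fps I R).

HB.instance Definition _ := gen_eqMixin (fps I R).
HB.instance Definition _ := gen_choiceMixin (fps I R).

Definition fps0 : fps I R := fun=> 0.
Definition fpsN f : fps I R := fun m => - f m.
Definition fpsD f g : fps I R := fun m => f m + g m.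
Definition fps1 : fps I R := fun m => (m == 1%M)%:R.
Definition fpsM f g : fps I R := fun m => \sum_(a <- mdivs m) f a * g (divcm m a).
Definition fpsZ (c : R) f : fps I R := fun m => c * f m.

Fact fpsDA : associative fpsD.
Proof. by move=> f g h; apply/funext => m; apply: addrA. Qed.
Fact fpsDC : commutative fpsD.
Proof. by move=> f g; apply/funext => m; apply: addrC. Qed.
Fact fps0D : left_id fps0 fpsD.
Proof. by move=> f; apply/funext => m; apply: add0r. Qed.
Fact fpsND : left_inverse fps0 fpsN fpsD.
Proof. by move=> f; apply/funext => m; apply: addNr. Qed.
HB.instance Definition _ := GRing.isZmodule.Build (fps I R) fpsDA fpsDC fps0D fpsND.

Lemma mem_mdivsP m a b : (a * b)%M = m -> a \in mdivs m.
Proof. by move=> e; rewrite mem_mdivs (divcmK e) e. Qed.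

Lemma mdivs_sub m a : a \in mdivs m -> (mdivs a `<=` mdivs m)%fset.
Proof.
rewrite mem_mdivs => /eqP e; apply/fsubsetP => b; rewrite mem_mdivs => /eqP e'.
by apply: (@mem_mdivsP _ _ (divcm a b * divcm m a)%M); rewrite mulmA e' e.
Qed.

Lemma fpsME (d : {fset {cmonom I}}) f g m : (mdivs m `<=` d)%fset ->
  fpsM f g m = \sum_(a <- d) \sum_(b <- d | (a * b == m)%M) f a * g b.
Proof.
move=> sd; rewrite -(big_fset_incl _ sd) => [|a _ am]; last first.
  by rewrite big1 // => b /eqP/mem_mdivsP; rewrite (negbTE am).
rewrite /fpsM !big_seq; apply: eq_bigr => a; rewrite mem_mdivs => /eqP e.
have dd : divcm m a \in d.
  by apply: (fsubsetP sd); apply: (@mem_mdivsP _ _ a); rewrite mulmC.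
rewrite big_mkcond (big_fsetD1 _ dd) e eqxx big1_fset => [/=|b]; first by rewrite addr0.
by rewrite !inE => /andP[nb _] _; case: eqP => // /divcmK eb; rewrite eb eqxx in nb.
Qed.

Fact fpsMC : commutative fpsM.
Proof.
move=> f g; apply/funext => m; rewrite !(fpsME _ _ (fsubset_refl _)).
under eq_bigr do rewrite big_mkcond.
rewrite exchange_big /=; apply: eq_bigr => a _; rewrite [RHS]big_mkcond.
by apply: eq_bigr => b _; rewrite mulmC mulrC.
Qed.

Lemma fpsM3E f g h m : fpsM f (fpsM g h) m =
  \sum_(a <- mdivs m) \sum_(b <- mdivs m) \sum_(c <- mdivs m | (a * b * c == m)%M)
    f a * g b * h c.
Proof.
rewrite (fpsME _ _ (fsubset_refl _)); set D := mdivs m.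
apply: eq_bigr => a _.
transitivity (\sum_(e <- D | (a * e == m)%M) \sum_(b <- D)
   \sum_(c <- D | (b * c == e)%M) f a * g b * h c).
  rewrite big_seq_cond [RHS]big_seq_cond.
  apply: eq_bigr => e /andP[eD _]; rewrite (fpsME _ _ (mdivs_sub eD)).
  rewrite mulr_sumr; apply: eq_bigr => b _; rewrite mulr_sumr.
  by apply: eq_bigr => c _; rewrite mulrA.
rewrite exchange_big /=; apply: eq_bigr => b _.
rewrite (exchange_big_dep predT) //= [RHS]big_mkcond; apply: eq_bigr => c _.
case: eqP => [e|ne]; last first.
  by rewrite big1 // => e /andP[/eqP e1 /eqP e2]; case: ne; rewrite -mulmA e2.
have bcD : (b * c)%M \in D by apply: (@mem_mdivsP _ _ a); rewrite mulmC mulmA.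
rewrite big_mkcond (big_fsetD1 _ bcD) mulmA e !eqxx.
rewrite big1_fset => [/=|x]; first by rewrite addr0.
rewrite in_fsetD1 => /andP[nx _] _; rewrite ifF //.
by apply: contraNF nx => /andP[_ /eqP->].
Qed.

Fact fpsMA : associative fpsM.
Proof.
move=> f g h; rewrite (fpsMC (fpsM f g)); apply/funext => m; rewrite !fpsM3E.
rewrite [RHS]exchange_big /=; apply: eq_bigr => a _.
under [RHS]eq_bigr do rewrite big_mkcond.
rewrite [RHS]exchange_big /=; apply: eq_bigr => b _.
rewrite [LHS]big_mkcond; apply: eq_bigr => c _.
rewrite [(c * a)%M]mulmC -[(a * c * b)%M]mulmA [(c * b)%M]mulmC mulmA.
by rewrite [f a * _ * _]mulrC mulrA.
Qed.

Fact fps1M : left_id fps1 fpsM.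
Proof.
move=> f; apply/funext => m.
have m1 : 1%M \in mdivs m by apply: (@mem_mdivsP _ _ m); rewrite mul1m.
rewrite /fpsM (big_fsetD1 _ m1) /fps1 eqxx mul1r.
rewrite big1_fset => [/=|a]; first rewrite addr0.
  by congr f; apply: divcmK; rewrite mul1m.
by rewrite !inE => /andP[/negbTE-> _] _; rewrite mul0r.
Qed.

Fact fpsMDl : left_distributive fpsM fpsD.
Proof.
move=> f g h; apply/funext => m; rewrite /fpsD /fpsM -big_split /=.
by apply: eq_bigr => a _; rewrite mulrDl.
Qed.

Fact fps1_neq0 : fps1 != 0 :> fps I R.
Proof.
apply/eqP => /(congr1 (fun f : fps I R => f 1%M)); rewrite /fps1 eqxx /=.
by apply/eqP/oner_neq0.
Qed.

HB.instance Definition _ := GRing.Zmodule_isComNzRing.Build (fps I R)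
  fpsMA fpsMC fps1M fpsMDl fps1_neq0.

Fact fpsZA (c c' : R) f : fpsZ c (fpsZ c' f) = fpsZ (c * c') f.
Proof. by apply/funext => m; apply: mulrA. Qed.
Fact fps1Z : left_id 1 fpsZ.
Proof. by move=> f; apply/funext => m; apply: mul1r. Qed.
Fact fpsZDr : right_distributive fpsZ +%R.
Proof. by move=> c f g; apply/funext => m; apply: mulrDr. Qed.
Fact fpsZDl f : {morph fpsZ^~ f : c c' / c + c'}.
Proof. by move=> c c'; apply/funext => m; apply: mulrDl. Qed.
HB.instance Definition _ := GRing.Zmodule_isLmodule.Build R (fps I R)
  fpsZA fps1Z fpsZDr fpsZDl.

Fact fpsZAl c f g : c *: (f * g) = (c *: f) * g.
Proof.
apply/funext => m; rewrite [LHS]mulr_sumr.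
by apply: eq_bigr => a _; rewrite mulrA.
Qed.
HB.instance Definition _ := GRing.Lmodule_isLalgebra.Build R (fps I R) fpsZAl.
HB.instance Definition _ := GRing.Lalgebra_isComAlgebra.Build R (fps I R).

Lemma fps1E m : (1 : fps I R) m = (m == 1%M)%:R. Proof. by []. Qed.
Lemma fpsDE f g m : (f + g) m = f m + g m. Proof. by []. Qed.
Lemma fpsZE c f m : (c *: f) m = c * f m. Proof. by []. Qed.
Lemma fps_mulE f g m : (f * g) m = \sum_(a <- mdivs m) f a * g (divcm m a).
Proof. by []. Qed.

Definition fps_var (i : I) : fps I R := fun m => (m == ucm i)%:R.
Definition fps_deriv (i : I) f : fps I R :=
  fun m => (m i).+1%:R * f (m * ucm i)%M.

End FPS.

(* Two countable families of variables, numbered from 0. In V they stand for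
   p_{i+1} (inl i) and \tilde p_{i+1} (inr i); in Lambda(X, Y) they stand for
   x_{i+1} (inl i) and y_{i+1} (inr i). *)
Definition bivar : Type := (nat + nat)%type.
HB.instance Definition _ := Choice.on bivar.

Definition bounded_degree (f : fps bivar rat) : Prop :=
  exists d : nat, forall m : {cmonom bivar}, (d < mdeg m)%N -> f m = 0.

Definition relabel (s t : nat -> nat) (v : bivar) : bivar :=
  match v with inl i => inl (s i) | inr i => inr (t i) end.

Definition bisymmetric (f : fps bivar rat) : Prop :=
  forall s t : nat -> nat, bijective s -> bijective t ->
  forall m m' : {cmonom bivar},
    (forall v, m' (relabel s t v) = m v) -> f m' = f m.

Definition lam_pred : {pred fps bivar rat} :=
  fun f => `[< bounded_degree f /\ bisymmetric f >].

Lemma bij_relabel s t : bijective s -> bijective t -> bijective (relabel s t).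
Proof.
move=> [s' sK s'K] [t' tK t'K]; exists (relabel s' t') => -[] i //=.
- by rewrite sK.
- by rewrite tK.
- by rewrite s'K.
- by rewrite t'K.
Qed.

Definition cmpush (h h' : bivar -> bivar) (m : {cmonom bivar}) : {cmonom bivar} :=
  mkcmonom [fsfun v in [fset h w | w in finsupp m]%fset => m (h' v) | 0%N].

Lemma cmpushE h h' m v : cancel h' h -> cmpush h h' m v = m (h' v).
Proof.
move=> h'K; rewrite /cmpush cmE fsfun_fun; case: ifPn => // vn; apply/esym/eqP.
rewrite cmE_eq0; apply: contraNN vn => vs.
by apply/imfsetP; exists (h' v); rewrite ?h'K.
Qed.

Lemma fpsM_reindex (h : bivar -> bivar) (f g : fps bivar rat) (m m' : {cmonom bivar}) :
  bijective h -> (forall v, m' (h v) = m v) ->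
  (forall a a' : {cmonom bivar}, (forall v, a' (h v) = a v) -> f a' = f a) ->
  (forall a a' : {cmonom bivar}, (forall v, a' (h v) = a v) -> g a' = g a) ->
  fpsM f g m' = fpsM f g m.
Proof.
move=> [h' hK h'K] em ef eg; pose r := cmpush h h'; pose r' := cmpush h' h.
have rE a v : r a v = a (h' v) by apply: cmpushE.
have r'E a v : r' a v = a (h v) by apply: cmpushE.
have rinj : injective r.
  by move=> a b /eqP/cmP e; apply/eqP/cmP => v; move: (e (h v)); rewrite !rE hK.
have dm : mdivs m' = [fset r a | a in mdivs m]%fset.
  apply/fsetP => a; apply/idP/imfsetP => [|[b /= bm ->]].
    rewrite mem_mdivs => /cmP ea; exists (r' a); last first.
      by apply/eqP/cmP => v; rewrite rE r'E h'K.
    apply: (@mem_mdivsP _ _ _ (r' (divcm m' a))); apply/eqP/cmP => v.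
    by rewrite cmM !r'E -em -[in RHS](ea (h v)) cmM.
  apply: (@mem_mdivsP _ _ _ (r (divcm m b))); apply/eqP/cmP => v.
  by move: bm; rewrite mem_mdivs => /cmP/(_ (h' v)); rewrite !cmM !rE -em h'K.
rewrite /fpsM dm big_imfset => [/=|a b _ _ /rinj //].
apply: eq_bigr => a _; congr (_ * _).
  by apply: ef => v; rewrite rE hK.
by apply: eg => v; rewrite !divcmE rE hK em.
Qed.

Fact lam_subalg_closed : subalg_closed lam_pred.
Proof.
split=> [|c f g /asboolP[[d fd] fs] /asboolP[[e ge] gs]
         |f g /asboolP[[d fd] fs] /asboolP[[e ge] gs]]; apply/asboolP; split.
- exists 0%N => m; rewrite lt0n mdeg_eq0 => m1.
  by rewrite fps1E (negbTE m1).
- move=> s t sb tb m m' e; rewrite !fps1E.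
  congr (nat_of_bool _)%:R; apply/cmP/cmP => e1 v; rewrite cm1.
    by rewrite -e e1 cm1.
  have [h' _ h'K] := bij_relabel sb tb.
  by rewrite -(h'K v) e e1 cm1.
- exists (d + e)%N => m lt; rewrite fpsDE fpsZE.
  by rewrite fd ?ge ?mulr0 ?addr0 // (leq_ltn_trans _ lt) ?leq_addr ?leq_addl.
- move=> s t sb tb m m' em; rewrite !fpsDE !fpsZE (fs _ _ sb tb _ _ em).
  by rewrite (gs _ _ sb tb _ _ em).
- exists (d + e)%N => m lt; rewrite fps_mulE big_seq big1 // => a.
  rewrite mem_mdivs => /eqP ea; rewrite -ea mdegM in lt.
  have [la|ga] := ltnP d (mdeg a); first by rewrite fd ?mul0r.
  by rewrite ge ?mulr0 // -(ltn_add2l d) (leq_trans lt) // leq_add2r.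
- move=> s t sb tb m m' em.
  apply: (fpsM_reindex (bij_relabel sb tb) em) => a a' ea.
    exact: fs ea.
  exact: gs ea.
Qed.
HB.instance Definition _ :=
  GRing.isSubalgClosed.Build rat (fps bivar rat) lam_pred lam_subalg_closed.

(* Lambda(X, Y) = Lambda(X) (x) Lambda(Y), realised as the algebra of power series
   of bounded degree in the x's and the y's that are invariant under permuting
   the x's and the y's independently: f (x) g corresponds to the product f * g. *)
Record Lambda := MkLambda { lam_val :> fps bivar rat; _ : lam_val \in lam_pred }.
HB.instance Definition _ := [isSub for lam_val].
HB.instance Definition _ := [Choice of Lambda by <:].
HB.instance Definition _ := [SubChoice_isSubComNzRing of Lambda by <:].
HB.instance Definition _ := [SubZmodule_isSubLmodule of Lambda by <:].
HB.instance Definition _ := [SubNzRing_SubLmodule_isSubLalgebra of Lambda by <:].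
HB.instance Definition _ := [SubLalgebra_isSubAlgebra of Lambda by <:].

(* \sum_i (e i)^k, for k >= 1 and e injective. *)
Definition power_sum (e : nat -> bivar) (k : nat) : fps bivar rat :=
  fun m => `[< exists i, m = expcmn (ucm (e i)) k >]%:R.

Lemma expcmnS (I : choiceType) (a : {cmonom I}) k :
  expcmn a k.+1 = (a * expcmn a k)%M.
Proof. by case: k => [|k] //; rewrite mulm1. Qed.

Lemma expcmnE (I : choiceType) (a : {cmonom I}) k v : expcmn a k v = (k * a v)%N.
Proof.
by elim: k => [|k IH]; rewrite ?cm1 // expcmnS cmM IH mulSn.
Qed.

Lemma power_sum_bounded e k : bounded_degree (power_sum e k).
Proof.
exists k => m lt; rewrite /power_sum; case: asboolP => // -[i em].
suff ek : mdeg m = k by rewrite ek ltnn in lt.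
rewrite em; elim: (k) => [|n IH]; first by rewrite mdeg1.
by rewrite expcmnS mdegM IH mdegU.
Qed.

Lemma power_sum_reindex (h : bivar -> bivar) (e : nat -> bivar) (s : nat -> nat) k
    (m m' : {cmonom bivar}) :
  bijective h -> bijective s -> (forall i, h (e i) = e (s i)) ->
  (forall v, m' (h v) = m v) -> power_sum e k m' = power_sum e k m.
Proof.
move=> [h' hK h'K] [s' sK s'K] he em; rewrite /power_sum.
congr (nat_of_bool _)%:R; apply: asbool_equiv_eq; split=> -[i ei].
  exists (s' i); apply/eqP/cmP => v; rewrite -em ei !expcmnE !ucmE.
  by rewrite -{1}(s'K i) -he (can_eq hK).
exists (s i); apply/eqP/cmP => v; rewrite -[v in LHS]h'K em ei !expcmnE !ucmE.
by rewrite -he -{2}(h'K v) (can_eq hK).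
Qed.

Fact psX_subproof k : power_sum inl k \in lam_pred.
Proof.
apply/asboolP; split=> [|s t bs bt m m']; first exact: power_sum_bounded.
exact: (power_sum_reindex _ (bij_relabel bs bt) bs).
Qed.

Fact psY_subproof k : power_sum inr k \in lam_pred.
Proof.
apply/asboolP; split=> [|s t bs bt m m']; first exact: power_sum_bounded.
exact: (power_sum_reindex _ (bij_relabel bs bt) bt).
Qed.

Definition psX (k : nat) : Lambda := MkLambda (psX_subproof k).
Definition psY (k : nat) : Lambda := MkLambda (psY_subproof k).

(* The derivative of a polynomial in the variables p_k, \tilde p_k. *)
Definition mp_deriv (v : bivar) (q : {malg rat[{cmonom bivar}]}) :
    {malg rat[{cmonom bivar}]} :=
  \sum_(m <- msupp q) << (m v)%:R * q@_m *g divcm m (ucm v) >>.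

(* The power sum that corresponds to the variable v of V. *)
Definition ps_gen (v : bivar) : Lambda :=
  match v with inl k => psX k.+1 | inr k => psY k.+1 end.

(* The isomorphism Q[p_1, p_2, ..., \tilde p_1, \tilde p_2, ...] -> Lambda(X, Y)
   that sends p_k and \tilde p_k to the k-th power sums in the x's and the y's. *)
Definition ps_eval (q : {malg rat[{cmonom bivar}]}) : Lambda :=
  mmap (in_alg Lambda)
    (fun m : {cmonom bivar} => \prod_(v <- finsupp m) ps_gen v ^+ m v) q.

(* The partial derivative with respect to the power sum ps_gen v: the expression
   of f as a polynomial q in the power sums exists and is unique, and it is q
   that is differentiated. *)
Definition lam_deriv (v : bivar) (f : Lambda) : Lambda :=
  ps_eval (mp_deriv v (xget 0 [set q | ps_eval q = f]%classic)).

Section DeltaBD.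
Context (A : comAlgType rat).

Section Delta.
(* d k and dt k play the parts of \partial_{p_k} and \partial_{\tilde p_k}, k >= 1. *)
Variables d dt : nat -> A -> A.

Definition Delta_factor (k M : nat) (f : A) : A :=
  \sum_(0 <= i < M) ((k ^ i)%:R / i`!%:R) *: iter i (d k \o dt k) f.

Definition Delta_trunc (N M : nat) : A -> A :=
  \big[comp/id]_(1 <= k < N) Delta_factor k M.

(* The infinite product of infinite sums: the common value of all the large enough
   truncations; 0 if the truncations are not eventually constant. *)
Definition Delta (f : A) : A :=
  xget 0 [set g | exists n0 : nat, forall N M : nat,
    (n0 <= N)%N -> (n0 <= M)%N -> Delta_trunc N M f = g]%classic.
End Delta.

(* L_n^{(a)}(t), for a natural number a. *)
Definition laguerre (n a : nat) (t : A) : A :=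
  \sum_(k < n.+1) ('C(n + a, n - k)%:R / k`!%:R) *: (- t) ^+ k.
End DeltaBD.

Record intpart := IntPart { parts :> seq nat; _ : sorted geq parts }.
Definition empty_part : intpart := @IntPart [::] isT.

Section Specht.
Variable la : intpart.
Local Notation m := (sumn la).
(* The tableau of shape la filled with 0, 1, ..., m - 1 in reading order: the
   entry i lies in row [reshape_index la i] and column [reshape_offset la i]. *)
Definition row_stab : {set 'S_m} :=
  [set s : 'S_m | [forall i, reshape_index la (s i) == reshape_index la i]].
Definition col_stab : {set 'S_m} :=
  [set s : 'S_m | [forall i, reshape_offset la (s i) == reshape_offset la i]].
Local Notation aG := (regular_repr rat [set: 'S_m]).
(* Permutations are multiplied from left to right here: this is a * b in the usual
   right-to-left convention, with a the sum of the row stabiliser and b the signed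
   sum of the column stabiliser, and the right ideal that it generates is the
   Specht module Q[S_m] * a * b of the usual convention. *)
Definition young_symmetrizer : 'M[rat]_#|[set: 'S_m]| :=
  (\sum_(s in col_stab) (-1) ^+ odd_perm s *: aG s) *m (\sum_(s in row_stab) aG s).
Definition specht_repr :=
  submod_repr (cyclic_mx_module aG (gring_row young_symmetrizer)).
Definition chi (s : 'S_m) : rat := \tr (specht_repr s).
End Specht.

Definition ncycles n (s : 'S_n) (k : nat) : nat :=
  #|[set c in porbits s | #|c| == k]|.

Section BD.
Context (A : comAlgType rat) (p pt : nat -> A).

(* F_k(pi, rho), where a = pi(k) and b = rho(k). *)
Definition BD_factor (k a b : nat) : A :=
  if (b <= a)%N then
    (k ^ b * b`!)%:R
      * laguerre b (a - b) (- (k%:R^-1 *: (p k * pt k))) * p k ^+ (a - b)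
  else
    (k ^ a * a`!)%:R
      * laguerre a (b - a) (- (k%:R^-1 *: (p k * pt k))) * pt k ^+ (b - a).

(* The factors with k > |la| + |mu| are all equal to 1. *)
Definition BD (la mu : intpart) : A :=
  (sumn la)`!%:R^-1 *: \sum_(pi : 'S_(sumn la))
  (sumn mu)`!%:R^-1 *: \sum_(rho : 'S_(sumn mu))
    (chi pi * chi rho) *:
    \prod_(1 <= k < (sumn la + sumn mu).+1) BD_factor k (ncycles pi k) (ncycles rho k).
End BD.

Notation V := (fps bivar rat).

Definition V_p (k : nat) : V := fps_var rat (inl k.-1 : bivar).
Definition V_pt (k : nat) : V := fps_var rat (inr k.-1 : bivar).
Definition BD_V (la mu : intpart) : V := BD V_p V_pt la mu.
Definition Delta_V : V -> V :=
  Delta (fun k => fps_deriv (inl k.-1 : bivar)) (fun k => fps_deriv (inr k.-1 : bivar)).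

Definition BD_Lambda (la mu : intpart) : Lambda := BD psX psY la mu.
Definition Delta_Lambda : Lambda -> Lambda :=
  Delta (fun k => lam_deriv (inl k.-1)) (fun k => lam_deriv (inr k.-1)).

(* Main.v *)
(* On polynomials in the p_k, pt_k, Delta is the product over k of the commuting
   operators exp(k d_k dt_k), and BD^{la,0} * BD^{0,mu} is a linear combination of
   products over k of the monomials p_k^a pt_k^b, with a = pi(k) and b = rho(k).
   The k-th operator sees only the k-th of these monomials, and
     exp(k d dt) (p^a pt^b) = \sum_i k^i / i! * a^_i * b^_i * p^(a-i) pt^(b-i),
   which is F_k once the Laguerre polynomial is expanded. This needs only
   derivations d_k, dt_k dual to the p_k, pt_k, so it applies to power series and
   to polynomials. Lambda(X, Y) is reached through the evaluation of polynomials at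
   the power sums, which is injective: of the products of d power sums, only
   the one with exponents e_1, ..., e_d has a monomial with d distinct variables
   raised to the powers e_1, ..., e_d, and products of fewer power sums have none. *)
From HB Require Import structures.
Require Import Defs.
From mathcomp Require Import all_boot all_order all_fingroup all_algebra.
From mathcomp Require Import mxrepresentation.
From mathcomp Require Import finmap monalg.
From mathcomp Require Import boolp classical_sets.
From mathcomp Require Import ring zify.

Set Implicit Arguments.
Unset Strict Implicit.
Unset Printing Implicit Defensive.

Import Order.TTheory GRing.Theory Num.Theory.
Local Open Scope ring_scope.

Local Notation "1" := (@mone _) : monom_scope.
Local Notation "x * y" := (mmul x y) : monom_scope.

(** * Delta on monomials *)

Definition leibniz (A : pzRingType) (D : A -> A) : Prop :=
  forall f g, D (f * g) = D f * g + f * D g.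

Section Derivations.
Context (A : comAlgType rat) (D : {linear A -> A}) (DM : leibniz D).

Lemma leibniz1 : D 1 = 0.
Proof. by apply: (addrI (D 1)); rewrite addr0 -[in RHS](mulr1 1) DM mulr1 mul1r. Qed.

Lemma leibniz_constM f g : D f = 0 -> D g = 0 -> D (f * g) = 0.
Proof. by move=> f0 g0; rewrite DM f0 g0 mul0r mulr0 addr0. Qed.

Lemma leibniz_constX f n : D f = 0 -> D (f ^+ n) = 0.
Proof.
by move=> f0; elim: n => [|n IH]; rewrite ?leibniz1 // exprS leibniz_constM.
Qed.

Lemma leibnizX x n : D x = 1 -> D (x ^+ n) = n%:R *: x ^+ n.-1.
Proof.
move=> Dx; elim: n => [|[|n] IH]; first by rewrite leibniz1 scale0r.
  by rewrite Dx scale1r.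
rewrite exprS DM Dx mul1r IH -scalerAr -exprS -[X in X + _]scale1r -scalerDl.
by rewrite -mulrS.
Qed.
End Derivations.

Lemma sum_ord_widen (V : nmodType) (F : nat -> V) n M : (n <= M)%N ->
  (forall i, (n <= i)%N -> F i = 0) ->
  \sum_(0 <= i < M) F i = \sum_(i < n) F i.
Proof.
move=> nM F0; rewrite (big_cat_nat (leq0n n) nM) /= [X in _ + X]big_nat.
by rewrite [X in _ + X]big1 => [|i /andP[/F0]//]; rewrite addr0 big_mkord.
Qed.

(** * The factors F_k as sums over the number of derivatives *)

Section Laguerre.
Context (A : comAlgType rat).
Implicit Types (p pt : nat -> A) (x y : A).

(** The two branches mirror each other and coincide at [a = b]; this lets the next proof assume
    [b <= a]. *)
Lemma BD_factorC p pt k a b : BD_factor p pt k a b = BD_factor pt p k b a.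
Proof.
by rewrite /BD_factor [pt k * _]mulrC; case: (ltngtP a b) => // ->; rewrite subnn.
Qed.

(** The right side is exp(k d dt) applied to p^a pt^b, cut off at any [M] past min(a, b): later
    falling factorials vanish. *)
Lemma BD_factorE p pt k a b M : (0 < k)%N -> (minn a b < M)%N ->
  BD_factor p pt k a b = \sum_(0 <= i < M)
    ((k ^ i)%:R / i`!%:R * (a ^_ i * b ^_ i)%:R) *: (p k ^+ (a - i) * pt k ^+ (b - i)).
Proof.
wlog ba : a b p pt / (b <= a)%N => [W|] k0 abM.
  case/orP: (leq_total b a) => [/W->//|/W E]; rewrite BD_factorC E //; last first.
    by rewrite minnC.
  by apply: eq_bigr => i _; rewrite mulnC [_ ^+ _ * _]mulrC.
rewrite (minn_idPr ba) in abM; rewrite (sum_ord_widen abM) => [|i bi]; last first.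
  by rewrite [b ^_ i]ffact_small // muln0 mulr0 scale0r.
(* The Laguerre index [j] counts the factors [p k * pt k] that survive, so [b - j] derivatives have
   been taken. *)
rewrite (reindex_inj rev_ord_inj) /= /BD_factor ba /laguerre.
rewrite mulr_sumr mulr_suml; apply: eq_bigr => -[j /=]; rewrite ltnS => jb _.
rewrite subSS subnKC // opprK exprZn exprMn mulr_natl -scaler_nat.
rewrite subKn // subnBA // addnC -addnBA // exprD.
rewrite [_ *: (_ *: (p k ^+ j * _))]scalerA scalerA -scalerAl [_ * _ * pt k ^+ j]mulrAC.
congr (_ *: _).
(* What remains is k^b b! C(a, b-j) / (k^j j!) = k^(b-j) a^_(b-j) b^_(b-j) / (b-j)!. *)
have Hk : (k ^ b)%:R = (k ^ (b - j))%:R * k%:R ^+ j :> rat.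
  by rewrite -natrX -natrM -expnD subnK.
have Hb : b`!%:R = (b ^_ (b - j))%:R * j`!%:R :> rat.
  by rewrite -(ffact_fact (leq_subr j b)) subKn // natrM.
have Ha : (a ^_ (b - j))%:R = 'C(a, b - j)%:R * (b - j)`!%:R :> rat.
  by rewrite -natrM bin_ffact.
rewrite !natrM Hk Hb Ha exprVn.
have k1 : k%:R ^+ j != 0 :> rat by rewrite expf_neq0 // pnatr_eq0 -lt0n.
have j1 : j`!%:R != 0 :> rat by rewrite pnatr_eq0 -lt0n fact_gt0.
have j2 : (b - j)`!%:R != 0 :> rat by rewrite pnatr_eq0 -lt0n fact_gt0.
by field; rewrite k1 j1 j2.
Qed.

Lemma BD_factor_r0 p pt k a : BD_factor p pt k a 0 = p k ^+ a.
Proof.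
rewrite /BD_factor leq0n /laguerre expn0 fact0 subn0 mul1r big_ord1 /= add0n bin0.
by rewrite divr1 scale1r expr0 mul1r.
Qed.

Lemma BD_factor_l0 p pt k b : BD_factor p pt k 0 b = pt k ^+ b.
Proof. by rewrite BD_factorC BD_factor_r0. Qed.
End Laguerre.

(** * Truncations of Delta on products of monomials *)

Section DeltaTrunc.
Context (A : comAlgType rat).

Lemma Delta_factor_is_linear (d dt : nat -> {linear A -> A}) k M :
  linear (Delta_factor d dt k M).
Proof.
have it i : linear (iter i (d k \o dt k)).
  by elim: i => [|i IH] c f g //=; rewrite IH !linearP.
move=> c f g; rewrite /Delta_factor scaler_sumr -big_split /=.
by apply: eq_bigr => i _; rewrite it scalerDr !scalerA [c * _]mulrC.
Qed.
HB.instance Definition _ (d dt : nat -> {linear A -> A}) k M :=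
  GRing.isLinear.Build rat A A _ (Delta_factor d dt k M) (Delta_factor_is_linear d dt k M).

Lemma Delta_trunc_is_linear (d dt : nat -> {linear A -> A}) N M :
  linear (Delta_trunc d dt N M).
Proof.
rewrite /Delta_trunc; apply: (big_ind (fun f : A -> A => linear f)) => //.
  by move=> f g lf lg c x y; rewrite /= lg lf.
by move=> k _; apply: linearP.
Qed.
HB.instance Definition _ (d dt : nat -> {linear A -> A}) N M :=
  GRing.isLinear.Build rat A A _ (Delta_trunc d dt N M) (Delta_trunc_is_linear d dt N M).

Context (p pt : nat -> A) (d dt : nat -> {linear A -> A}).
Hypotheses (dM : forall k, leibniz (d k)) (dtM : forall k, leibniz (dt k)).
(** In the instances [p 0] and [p 1] are the same variable, because of [k.-1], so duality can hold
    only for positive indices. *)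
Hypotheses (dp : forall k l, (0 < k)%N -> (0 < l)%N -> d k (p l) = (k == l)%:R)
  (dpt : forall k l, d k (pt l) = 0) (dtp : forall k l, dt k (p l) = 0)
  (dtpt : forall k l, (0 < k)%N -> (0 < l)%N -> dt k (pt l) = (k == l)%:R).

Let const k c := d k c = 0 /\ dt k c = 0.

Let constM k c e : const k c -> const k e -> const k (c * e).
Proof. by case=> c1 c2 [e1 e2]; split; apply: leibniz_constM. Qed.

Let const_gen k l a b : (0 < k)%N -> (0 < l)%N -> k != l ->
  const k (p l ^+ a * pt l ^+ b).
Proof.
move=> k0 l0 /negbTE kl.
by apply: constM; split; apply: leibniz_constX; rewrite ?dp ?dtpt ?kl.
Qed.

Let const_BD_factor k l a b : (0 < k)%N -> (0 < l)%N -> k != l ->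
  const k (BD_factor p pt l a b).
Proof.
move=> k0 l0 kl; rewrite (BD_factorE _ _ l0 (leqnn _)).
split; rewrite linear_sum big1 // => i _; rewrite linearZ /=.
  by rewrite (const_gen _ _ k0 l0 kl).1 scaler0.
by rewrite (const_gen _ _ k0 l0 kl).2 scaler0.
Qed.

(** Each step lowers both exponents by one and brings down the next factors of the two falling
    factorials; [c] passes through as a constant. *)
Lemma iter_deriv_gen k a b c i : (0 < k)%N -> const k c ->
  iter i (d k \o dt k) (p k ^+ a * pt k ^+ b * c) =
  (a ^_ i * b ^_ i)%:R *: (p k ^+ (a - i) * pt k ^+ (b - i) * c).
Proof.
move=> k0 [c1 c2]; elim: i => [|i IH]; first by rewrite !ffactn0 !subn0 scale1r.
have dX j : d k (p k ^+ j) = j%:R *: p k ^+ j.-1 by apply: leibnizX; rewrite ?dp ?eqxx.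
have dtX j : dt k (pt k ^+ j) = j%:R *: pt k ^+ j.-1.
  by apply: leibnizX; rewrite ?dtpt ?eqxx.
rewrite iterS IH /= linearZ linearZ /= dtM c2 mulr0 addr0.
rewrite dtM (leibniz_constX (dtM k)) ?dtp // mul0r add0r dtX -scalerAr -scalerAl linearZ /=.
rewrite dM c1 mulr0 addr0 dM dX [d k (pt k ^+ _)](leibniz_constX (dM k)) ?dpt //.
rewrite mulr0 addr0 -2!scalerAl !scalerA !ffactnSr -!subnS -!natrM.
by congr (_%:R *: _); ring.
Qed.

Lemma Delta_factor_gen k a b c M : (0 < k)%N -> (minn a b < M)%N -> const k c ->
  Delta_factor d dt k M (p k ^+ a * pt k ^+ b * c) = BD_factor p pt k a b * c.
Proof.
move=> k0 abM cc; rewrite (BD_factorE _ _ k0 abM) mulr_suml.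
by apply: eq_bigr => i _; rewrite iter_deriv_gen // scalerA -scalerAl.
Qed.

Lemma Delta_trunc_gen (a b : nat -> nat) N M :
  (forall k, minn (a k) (b k) < M)%N ->
  Delta_trunc d dt N M (\prod_(1 <= k < N) (p k ^+ a k * pt k ^+ b k)) =
  \prod_(1 <= k < N) BD_factor p pt k (a k) (b k).
Proof.
move=> abM; rewrite /Delta_trunc.
(* The composite applies the largest index first. When the operator of index [s] acts, the later
   monomials have already become [BD_factor]s and [c] holds the earlier monomials; both are
   constants for it. *)
suff E n s c : (0 < s)%N -> (forall k, (s <= k)%N -> const k c) ->
  (\big[comp/id]_(s <= k < s + n) Delta_factor d dt k M)
    (\prod_(s <= k < s + n) (p k ^+ a k * pt k ^+ b k) * c) =
  \prod_(s <= k < s + n) BD_factor p pt k (a k) (b k) * c.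
  have [N1|N1] := leqP N 1; first by rewrite !big_geq.
  have := E N.-1 1%N 1 isT; rewrite add1n prednK; last exact: ltnW.
  rewrite !mulr1; apply => k _.
  by split; apply: leibniz1.
elim: n s c => [|n IH] s c s0 cc; first by rewrite addn0 !big_geq.
have sn : (s < s + n.+1)%N by rewrite addnS ltnS leq_addr.
rewrite !(big_ltn sn) /= -addSnnS [_ * _ * c]mulrAC [_ * _ * \prod_(_ <= _ < _) _]mulrC.
rewrite IH //; last first.
  move=> k sk; apply: constM; last exact/cc/ltnW.
  by apply: const_gen => //; [apply: leq_trans sk | rewrite gtn_eqF].
rewrite mulrCA Delta_factor_gen //; first by rewrite mulrA.
apply: constM; last exact: cc.
rewrite big_seq; apply: (big_ind (const s)) => //; first by split; apply: leibniz1.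
  by move=> *; apply: constM.
move=> k; rewrite mem_index_iota => /andP[sk _].
by apply: const_BD_factor => //; [apply: leq_trans sk | rewrite ltn_eqF].
Qed.
End DeltaTrunc.

(** * The products BD^{la,0} BD^{0,mu} *)

(** Two eventual values agree at a common large truncation, so the choice in [Delta] is forced to be
    [g]. *)
Lemma DeltaE (A : comAlgType rat) (d dt : nat -> A -> A) f g n0 :
  (forall N M, (n0 <= N)%N -> (n0 <= M)%N -> Delta_trunc d dt N M f = g) ->
  Delta d dt f = g.
Proof.
move=> fg; rewrite /Delta; case: xgetP => [h _ [n1 fh]|/(_ g)[]]; last by exists n0.
by rewrite -(fh (maxn n0 n1) (maxn n0 n1)) ?leq_maxr // fg ?leq_maxl.
Qed.

Lemma ncycles_small n (s : 'S_n) k : (n < k)%N -> ncycles s k = 0%N.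
Proof.
move=> nk; apply: eq_card0 => c; rewrite !inE; apply/negP => /andP[_ /eqP ck].
by move: nk; rewrite -ck ltnNge -[X in (_ <= X)%N]card_ord max_card.
Qed.

Lemma ncycles_le n (s : 'S_n) k : (ncycles s k <= n)%N.
Proof.
rewrite (leq_trans (n := #|porbits s|)) ?subset_leq_card //.
  by apply/fintype.subsetP => c; rewrite inE => /andP[].
by rewrite (leq_trans (leq_imset_card _ _)) // card_ord.
Qed.

(** * The character of the empty partition *)

Lemma perm0_eq (s : 'S_0) : s = 1%g.
Proof. by apply/permP => -[]. Qed.

Lemma set_perm0 (S : {set 'S_0}) : 1%g \in S -> S = [set 1%g].
Proof. by move=> S1; apply/setP => t; rewrite (perm0_eq t) S1 inE eqxx. Qed.

Lemma young_symmetrizer_empty : young_symmetrizer empty_part = 1%:M.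
Proof.
have r1 : row_stab empty_part = [set 1%g].
  by apply: set_perm0; rewrite inE; apply/forallP => -[].
have c1 : col_stab empty_part = [set 1%g].
  by apply: set_perm0; rewrite inE; apply/forallP => -[].
rewrite /young_symmetrizer r1 c1 (big_set1 _ (1%g : 'S_(sumn empty_part))) big_set1.
by rewrite odd_perm1 expr0 scale1r repr_mx1 mulmx1.
Qed.

(** On S_0 the trace is the dimension of the Specht module. It is at most |S_0| = 1, and not 0
    because the module contains its generator, whose coordinate at the identity is 1. *)
Lemma chi_empty (s : 'S_(sumn empty_part)) : chi s = 1.
Proof.
rewrite (perm0_eq s) /chi repr_mx1 mxtrace1.
apply: (congr1 (fun n => n%:R : rat) (_ : _ = 1%N)); apply/eqP.
rewrite eqn_leq; apply/andP; split.
  by rewrite (leq_trans (rank_leq_col _)) // /gcard cardsT card_Sn.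
rewrite lt0n mxrank_eq0; apply/eqP => cyc0.
have := cyclic_mx_id (regular_repr rat [set: 'S_(sumn empty_part)])
  (gring_row (young_symmetrizer empty_part)).
rewrite cyc0 submx0 => /eqP; rewrite young_symmetrizer_empty.
move=> /rowP/(_ (gring_index [set: _] 1%g)); rewrite !mxE eqxx => /eqP.
by rewrite oner_eq0.
Qed.

Section BDProduct.
Context (A : comAlgType rat) (p pt : nat -> A).
Local Notation E := empty_part.
Implicit Types la mu : intpart.

Lemma sum_perm0 (F : 'S_(sumn E) -> A) : \sum_s F s = F 1%g.
Proof. by apply: big_pred1 => s; rewrite /= (perm0_eq s) eqxx. Qed.

(** No cycle of a permutation of n points is longer than n; this brings products of different
    degrees to a common range. *)
Lemma prod_ncyclesX (x : nat -> A) n (s : 'S_n) N : (n < N)%N ->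
  \prod_(1 <= k < N) x k ^+ ncycles s k = \prod_(1 <= k < n.+1) x k ^+ ncycles s k.
Proof.
move=> nN; rewrite (big_cat_nat (n := n.+1)) //= [X in _ * X]big_nat.
by rewrite [X in _ * X]big1 ?mulr1 // => k /andP[nk _]; rewrite ncycles_small.
Qed.

Lemma BD_r0 la N : (sumn la < N)%N ->
  BD p pt la E = (sumn la)`!%:R^-1 *:
    \sum_(s : 'S_(sumn la)) chi s *: \prod_(1 <= k < N) p k ^+ ncycles s k.
Proof.
move=> laN; rewrite /BD; congr (_ *: _); apply: eq_bigr => s _.
rewrite sum_perm0 chi_empty mulr1 fact0 invr1 scale1r addn0 prod_ncyclesX //.
congr (_ *: _); apply: eq_big_nat => k /andP[k0 _].
by rewrite [ncycles 1%g k]ncycles_small // BD_factor_r0.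
Qed.

Lemma BD_l0 mu N : (sumn mu < N)%N ->
  BD p pt E mu = (sumn mu)`!%:R^-1 *:
    \sum_(s : 'S_(sumn mu)) chi s *: \prod_(1 <= k < N) pt k ^+ ncycles s k.
Proof.
move=> muN; rewrite /BD sum_perm0 fact0 invr1 scale1r; congr (_ *: _).
apply: eq_bigr => s _; rewrite chi_empty mul1r prod_ncyclesX //.
congr (_ *: _); apply: eq_big_nat => k /andP[k0 _].
by rewrite [ncycles 1%g k]ncycles_small // BD_factor_l0.
Qed.

Lemma BD_widen la mu N : (sumn la + sumn mu < N)%N ->
  BD p pt la mu = (sumn la)`!%:R^-1 *: \sum_(s : 'S_(sumn la))
    (sumn mu)`!%:R^-1 *: \sum_(t : 'S_(sumn mu)) (chi s * chi t) *:
    \prod_(1 <= k < N) BD_factor p pt k (ncycles s k) (ncycles t k).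
Proof.
move=> sN; rewrite /BD; congr (_ *: _); apply: eq_bigr => s _; congr (_ *: _).
apply: eq_bigr => t _; congr (_ *: _).
rewrite [RHS](big_cat_nat (n := (sumn la + sumn mu).+1)) //=.
rewrite [X in _ = _ * X]big_nat [X in _ = _ * X]big1 ?mulr1 // => k /andP[nk _].
rewrite !ncycles_small ?BD_factor_r0 //.
  by rewrite (leq_ltn_trans _ nk) // leq_addl.
by rewrite (leq_ltn_trans _ nk) // leq_addr.
Qed.

Lemma BD_mul la mu N : (sumn la + sumn mu < N)%N ->
  BD p pt la E * BD p pt E mu = (sumn la)`!%:R^-1 *: \sum_(s : 'S_(sumn la))
    (sumn mu)`!%:R^-1 *: \sum_(t : 'S_(sumn mu)) (chi s * chi t) *:
    \prod_(1 <= k < N) (p k ^+ ncycles s k * pt k ^+ ncycles t k).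
Proof.
move=> sN; rewrite (BD_r0 (N := N)) ?(BD_l0 (N := N)); last first.
- by rewrite (leq_ltn_trans _ sN) // leq_addr.
- by rewrite (leq_ltn_trans _ sN) // leq_addl.
rewrite -scalerAl mulr_suml; congr (_ *: _); apply: eq_bigr => s _.
rewrite -scalerAr mulr_sumr; congr (_ *: _); apply: eq_bigr => t _.
by rewrite -scalerAl -scalerAr scalerA big_split.
Qed.

Variables (d dt : nat -> {linear A -> A}).
Hypotheses (dM : forall k, leibniz (d k)) (dtM : forall k, leibniz (dt k)).
Hypotheses (dp : forall k l, (0 < k)%N -> (0 < l)%N -> d k (p l) = (k == l)%:R)
  (dpt : forall k l, d k (pt l) = 0) (dtp : forall k l, dt k (p l) = 0)
  (dtpt : forall k l, (0 < k)%N -> (0 < l)%N -> dt k (pt l) = (k == l)%:R).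

Lemma Delta_trunc_BD la mu N M :
  (sumn la + sumn mu < N)%N -> (sumn la + sumn mu < M)%N ->
  Delta_trunc d dt N M (BD p pt la E * BD p pt E mu) = BD p pt la mu.
Proof.
move=> nN nM; rewrite (BD_mul nN) (BD_widen nN) linearZ linear_sum; congr (_ *: _).
apply: eq_bigr => s _; rewrite linearZ linear_sum; congr (_ *: _).
apply: eq_bigr => t _; rewrite linearZ; congr (_ *: _).
apply: (@Delta_trunc_gen _ p pt d dt) => // k.
(* [M] must exceed every min(pi(k), rho(k)), and a permutation of n points has at most n cycles. *)
by rewrite (leq_ltn_trans _ nM) // geq_min (leq_trans (ncycles_le _ _)) ?leq_addr.
Qed.
End BDProduct.

(** * Power series *)

Section SeriesDerivative.
Context (I : choiceType) (R : comNzRingType) (v : I).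
Implicit Types (f g : fps I R) (m : {cmonom I}).

Lemma fps_deriv_is_linear : linear (@fps_deriv I R v).
Proof.
by move=> c f g; apply/funext => m; rewrite /fps_deriv !fpsDE !fpsZE mulrDr mulrCA.
Qed.
HB.instance Definition _ :=
  GRing.isLinear.Build R (fps I R) (fps I R) _ (@fps_deriv I R v) fps_deriv_is_linear.

(** The operator X_v d/dX_v. Exponents add under products of monomials, so its Leibniz rule holds
    term by term, and that of the derivative follows by a shift. *)
Definition fps_euler f : fps I R := fun m => (m v)%:R * f m.

Lemma fps_derivE f m : fps_deriv v f m = fps_euler f (m * ucm v)%M.
Proof. by rewrite /fps_euler cmM cmUU addn1. Qed.

Lemma fps_eulerM f g : fps_euler (f * g) = fps_euler f * g + f * fps_euler g.
Proof.
apply/funext => m; rewrite /fps_euler fpsDE !fps_mulE mulr_sumr -big_split /=.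
rewrite !big_seq; apply: eq_bigr => a; rewrite mem_mdivs => /eqP e.
by rewrite -[in m v]e cmM natrD mulrDl mulrA [f a * (_ * _)]mulrCA.
Qed.

(** In the left convolution, divisors of m X_v not divisible by X_v get Euler weight 0; the others
    are X_v times the divisors of m. *)
Lemma fps_eulerM_shift f g m : (fps_euler f * g) (m * ucm v)%M = (fps_deriv v f * g) m.
Proof.
have injv : injective (fun a : {cmonom I} => (a * ucm v)%M).
  move=> a b /eqP/cmP e; apply/eqP/cmP => i; have := e i.
  by rewrite !cmM => /addIn.
rewrite !fps_mulE; set S := [fset (a * ucm v)%M | a in mdivs m]%fset.
have SD : (S `<=` mdivs (m * ucm v)%M)%fset.
  apply/fsubsetP => _ /imfsetP[a /= am ->].
  apply: (@mem_mdivsP _ _ _ (divcm m a)).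
  rewrite -mulmA [(ucm v * _)%M]mulmC mulmA.
  by congr (_ * _)%M; apply/eqP; rewrite -mem_mdivs.
rewrite -(big_fset_incl _ SD) => [|a]; last first.
  rewrite mem_mdivs => /eqP e aS; rewrite /fps_euler.
  have [->|av] := eqVneq (a v) 0%N; first by rewrite !mul0r.
  case/negP: aS; apply/imfsetP; exists (divcm a (ucm v)) => /=.
    apply: (@mem_mdivsP _ _ _ (divcm (m * ucm v)%M a)).
    apply/eqP/cmP => i; move/eqP/cmP/(_ i): e; rewrite !cmM !divcmE !cmM !cmU.
    by case: (eqVneq v i) av => [<-|_]; lia.
  apply/eqP/cmP => i; rewrite cmM divcmE cmU.
  by case: (eqVneq v i) av => [<-|_]; lia.
rewrite big_imfset /=; last by move=> a b _ _; apply: injv.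
rewrite !big_seq; apply: eq_bigr => a; rewrite mem_mdivs => /eqP e.
rewrite fps_derivE; congr (_ * g _); apply: divcmK.
by rewrite -[in RHS]e -!mulmA [(ucm v * _)%M]mulmC.
Qed.

Lemma fps_derivM : leibniz (@fps_deriv I R v).
Proof.
move=> f g; apply/funext => m.
rewrite fps_derivE fps_eulerM fpsDE fps_eulerM_shift [f * fps_euler g]mulrC.
by rewrite fps_eulerM_shift [fps_deriv v g * f]mulrC.
Qed.

Lemma fps_deriv_var w : fps_deriv v (fps_var R w) = (v == w)%:R.
Proof.
apply/funext => m; rewrite /fps_deriv /fps_var.
have [->|m1] := eqVneq m 1%M.
  rewrite mul1m cm1 mul1r.
  have -> : (ucm v == ucm w) = (v == w).
    apply/eqP/eqP => [/eqP/cmP/(_ w)|->//].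
    by rewrite !cmU eqxx; case: eqVneq.
  by case: (v == w) => //=; rewrite !mulr1n fps1E eqxx.
have -> : (m * ucm v == ucm w)%M = false.
  apply/negP => /eqP/(congr1 mdeg); rewrite mdegM !mdegU => /eqP.
  by rewrite -[X in _ == X]add0n eqn_add2r mdeg_eq0 (negbTE m1).
by rewrite mulr0; case: (v == w) => //=; rewrite mulr1n fps1E (negbTE m1).
Qed.
End SeriesDerivative.

Lemma Delta_BD_V la mu :
  Delta_V (BD_V la empty_part * BD_V empty_part mu) = BD_V la mu.
Proof.
pose d k : {linear fps bivar rat -> fps bivar rat} := fps_deriv (inl k.-1 : bivar).
pose dt k : {linear fps bivar rat -> fps bivar rat} := fps_deriv (inr k.-1 : bivar).
apply: (@DeltaE _ d dt _ _ (sumn la + sumn mu).+1) => N M.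
by apply: Delta_trunc_BD => [k|k|[|k] [|l] //|k l|k l|[|k] [|l] //];
  do ?[exact: fps_derivM]; rewrite /= /V_p /V_pt fps_deriv_var.
Qed.

(** * Polynomials and the independence of the power sums *)

Section Coefficients.
Context (I : choiceType) (R : comNzRingType).
Implicit Types (q : {malg R[{cmonom I}]}) (m : {cmonom I}).

(** This embedding is injective, multiplicative and compatible with derivatives, so it pulls the
    rules for [mp_deriv] back from [fps_deriv]. *)
Definition malg_fps q : fps I R := fun m => q@_m.

Lemma malg_fps_inj : injective malg_fps.
Proof. by move=> q r e; apply/malgP => m; rewrite -[q@_m]/(malg_fps q m) e. Qed.

Lemma malg_fps_linear c q r : malg_fps (c *: q + r) = c *: malg_fps q + malg_fps r.
Proof. by apply/funext => m; rewrite /malg_fps mcoeffD mcoeffZ. Qed.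

Lemma malg_fpsD q r : malg_fps (q + r) = malg_fps q + malg_fps r.
Proof. by rewrite -[q]scale1r malg_fps_linear !scale1r. Qed.

Lemma malg_fpsM q r : malg_fps (q * r) = malg_fps q * malg_fps r.
Proof.
apply/funext => m; pose d := (mdivs m `|` msupp q `|` msupp r)%fset.
have qd : (msupp q `<=` d)%fset by rewrite /d fsubsetU // fsubsetUr.
have rd : (msupp r `<=` d)%fset by rewrite fsubsetUr.
rewrite [RHS](fpsME (d := d)); last by rewrite /d -fsetUA fsubsetUl.
rewrite /malg_fps (mcoeffMlw _ qd rd); apply: eq_bigr => a _.
by rewrite [RHS]big_mkcond; apply: eq_bigr => b _; case: eqP.
Qed.
End Coefficients.

Section PolynomialDerivative.
Implicit Types (v w : bivar) (q r : {malg rat[{cmonom bivar}]}).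

Lemma mp_deriv_fps v q : malg_fps (mp_deriv v q) = fps_deriv v (malg_fps q).
Proof.
apply/funext => m; rewrite /malg_fps /mp_deriv raddf_sum /=.
(* [divcm] truncates, so it fixes a monomial without X_v; such an [n] is excluded here and has
   weight [n v = 0] in the sum. *)
have dE n : divcm n (ucm v) == m -> (0 < n v)%N -> n = (m * ucm v)%M.
  move=> /cmP e nv; apply/eqP/cmP => i; have := e i; rewrite divcmE cmM cmU.
  by case: (eqVneq v i) nv => [<-|_]; lia.
have mvE : divcm (m * ucm v)%M (ucm v) = m by apply: divcmK; rewrite mulmC.
have mv : (m v).+1 = (m * ucm v)%M v by rewrite cmM cmUU addn1.
rewrite /fps_deriv mv; move: (m * ucm v)%M dE mvE {mv} => k dE kE.
case: (msuppP q k) => [kq|nq]; last first.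
  rewrite mulr0 big_seq big1 // => n nin; rewrite mcoeffU.
  case: eqP => [e|]; last by rewrite mulr0n.
  case: (posnP (n v)) => [->|nv]; first by rewrite mul0r.
  by rewrite -(dE n) ?e ?nin in nq.
rewrite (big_fsetD1 k kq) /= [X in X + _]mcoeffU kE eqxx mulr1n.
rewrite big1_fset ?addr0 // => n; rewrite in_fsetD1 => /andP[nm _] _.
rewrite mcoeffU; case: eqP => [e|]; last by rewrite mulr0n.
case: (posnP (n v)) => [->|nv]; first by rewrite mul0r.
by rewrite -(dE n) ?e ?eqxx in nm.
Qed.

Lemma mp_deriv_is_linear v : linear (mp_deriv v).
Proof.
move=> c q r; apply: malg_fps_inj.
rewrite mp_deriv_fps (malg_fps_linear c q r) linearP /= -!mp_deriv_fps.
exact/esym/malg_fps_linear.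
Qed.
HB.instance Definition _ v := GRing.isLinear.Build rat {malg rat[{cmonom bivar}]}
  {malg rat[{cmonom bivar}]} _ (mp_deriv v) (mp_deriv_is_linear v).

Lemma mp_derivM v : leibniz (mp_deriv v).
Proof.
move=> q r; apply: malg_fps_inj; rewrite mp_deriv_fps (malg_fpsM q r) fps_derivM -!mp_deriv_fps.
rewrite -(malg_fpsM (mp_deriv v q)) -(malg_fpsM q).
exact/esym/malg_fpsD.
Qed.

Lemma mp_deriv_var v w : mp_deriv v << ucm w >> = (v == w)%:R.
Proof.
apply: malg_fps_inj; rewrite mp_deriv_fps.
have -> : malg_fps << ucm w >> = fps_var rat w.
  by apply/funext => m; rewrite /malg_fps mcoeffU1 /fps_var eq_sym.
rewrite fps_deriv_var; apply/funext => m; rewrite /malg_fps.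
by case: (v == w); rewrite ?mulr1n ?mcoeff1 ?mcoeff0.
Qed.
End PolynomialDerivative.

Section MonomialEvaluation.
Context (I : choiceType) (A : comNzRingType) (g : I -> A).
Implicit Types m : {cmonom I}.

Definition monom_eval m : A := \prod_(v <- finsupp m) g v ^+ m v.

Lemma monom_evalE (d : {fset I}) m : (finsupp m `<=` d)%fset ->
  monom_eval m = \prod_(v <- d) g v ^+ m v.
Proof.
move=> md; apply: (big_fset_incl _ md) => v _.
by rewrite -cmE_eq0 => /eqP->.
Qed.

Lemma monom_eval_mmorphism : mmorphism monom_eval.
Proof.
split=> [m n|]; last by rewrite /monom_eval mdom1 big_seq_fset0.
rewrite (monom_evalE (fsubset_refl (finsupp (m * n)%M))) mdomD.
rewrite (monom_evalE (fsubsetUl (finsupp m) (finsupp n))).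
rewrite (monom_evalE (fsubsetUr (finsupp m) (finsupp n))) -big_split /=.
by apply: eq_bigr => v _; rewrite cmM exprD.
Qed.
HB.instance Definition _ :=
  monalg.isMultiplicative.Build {cmonom I} A monom_eval monom_eval_mmorphism.

Lemma monom_evalU v : monom_eval (ucm v) = g v.
Proof. by rewrite /monom_eval mdomU big_seq_fset1 cmUU expr1. Qed.
End MonomialEvaluation.

Lemma cmonom_ind (I : choiceType) (P : {cmonom I} -> Prop) :
  P 1%M -> (forall v m, P m -> P (ucm v * m)%M) -> forall m, P m.
Proof.
move=> P1 PM m; move: {2}(mdeg m) (erefl (mdeg m)) => n.
elim: n m => [|n IH] m mn; first by rewrite (mdeg_eq0I mn).
have [m0|[v vm]] := fset_0Vmem (finsupp m).
  by move: mn; rewrite mdegE m0 big_seq_fset0.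
have e : (ucm v * divcm m (ucm v))%M = m.
  apply/eqP/cmP => i; rewrite cmM divcmE cmU; move: vm; rewrite -cmE_neq0.
  by case: (eqVneq v i) => [<-|_]; lia.
rewrite -e; apply/PM/IH; apply/eqP; rewrite -(eqn_add2l 1) -(mdegU v).
by rewrite -mdegM e mn mdegU.
Qed.

Lemma fpsM_neq0 (I : choiceType) (R : comNzRingType) (f g : fps I R) m :
  (f * g) m != 0 -> exists a b, [/\ (a * b)%M = m, f a != 0 & g b != 0].
Proof.
rewrite fps_mulE => fg; apply: contrapT => H; case/eqP: fg.
rewrite big_seq big1 // => a; rewrite mem_mdivs => /eqP e.
have [->|fa] := eqVneq (f a) 0; first by rewrite mul0r.
have [->|gb] := eqVneq (g (divcm m a)) 0; first by rewrite mulr0.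
by case: H; exists a, (divcm m a).
Qed.

(** * Algebraic independence of the power sums *)

Section Independence.
Implicit Types (u v : bivar) (m n : {cmonom bivar}).

Definition alphabet v (i : nat) : bivar :=
  match v with inl _ => inl i | inr _ => inr i end.
Definition gen_index v : nat := match v with inl k | inr k => k end.

Definition gen_fps v : fps bivar rat := power_sum (alphabet v) (gen_index v).+1.

(* Records the exponents of m, forgetting which variables carry them: x_i ^ e
   gives p_e, numbered e - 1 in [bivar], so that a product of d power sums has a
   monomial m with d distinct variables only if it is [exponent_monom m]. *)
Definition exponent_monom m : {cmonom bivar} :=
  \big[mmul/1%M]_(u <- finsupp m) ucm (alphabet u (m u).-1).

Lemma gen_fps_neq0 v m : gen_fps v m != 0 ->
  exists i, m = expcmn (ucm (alphabet v i)) (gen_index v).+1.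
Proof. by rewrite /gen_fps /power_sum; case: asboolP => //= _; rewrite eqxx. Qed.

Lemma gen_fps_power v i : gen_fps v (expcmn (ucm (alphabet v i)) (gen_index v).+1) = 1.
Proof. by rewrite /gen_fps /power_sum; case: asboolP => // -[]; exists i. Qed.

Lemma gen_fps_ge0 v m : 0 <= gen_fps v m.
Proof. by rewrite /gen_fps /power_sum ler0n. Qed.

Lemma finsupp_exp u k : finsupp (expcmn (ucm u) k.+1) = [fset u]%fset.
Proof.
apply/fsetP => w; rewrite -cmE_neq0 expcmnE cmU inE [w == u]eq_sym muln_eq0 /=.
by case: (u == w).
Qed.

(** Each power sum contributes a power of a single variable, so d of them yield at most d variables.
    Equality forces distinct variables, and then each exponent identifies its generator. *)
Lemma monom_eval_gen_neq0 n m : monom_eval gen_fps n m != 0 ->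
  (#|` finsupp m| <= mdeg n)%N /\ (#|` finsupp m| = mdeg n -> exponent_monom m = n).
Proof.
elim/cmonom_ind: n m => [|v n IH] m.
  rewrite mmorph1 fps1E; case: (eqVneq m 1%M) => [->|_]; last by rewrite eqxx.
  by rewrite mdom1 cardfs0 mdeg1 /exponent_monom mdom1 big_seq_fset0.
rewrite mmorphM /= monom_evalU => /fpsM_neq0[a [b [<-]]] /gen_fps_neq0[i ea].
move=> /IH[le_b eq_b]; set x := alphabet v i in ea.
have fa : finsupp a = [fset x]%fset by rewrite ea finsupp_exp.
have aE u : a u = ((gen_index v).+1 * (x == u))%N by rewrite ea expcmnE cmU.
rewrite /exponent_monom mdomD fa cardfsU1 mdegM mdegU.
split=> [|e]; first by rewrite leq_add // leq_b1.
(* If [x] occurred in [b], the product would have at most [mdeg n] variables, one too few for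
   equality. *)
have xb : x \notin finsupp b.
  by case: (x \in finsupp b) e => //; rewrite add0n => e; rewrite e ltnn in le_b.
move: e; rewrite xb => /addnI e; rewrite big_fsetU1 //= -(eq_b e).
rewrite cmM aE eqxx (eqP (_ : b x == 0%N)) ?cmE_eq0 // muln1 addn0.
congr (_ * _)%M; first by rewrite /x; case: (v).
rewrite /exponent_monom !big_seq; apply: eq_bigr => u ub; rewrite cmM aE.
have /negbTE-> : x != u by apply: contraNneq xb => ->.
by rewrite muln0.
Qed.

(** Excludes cancellation: in the next lemma a single positive term makes the coefficient
    positive. *)
Lemma monom_eval_gen_ge0 n m : 0 <= monom_eval gen_fps n m.
Proof.
elim/cmonom_ind: n m => [|v n IH] m; first by rewrite mmorph1 fps1E ler0n.
rewrite mmorphM /= monom_evalU fps_mulE; apply: sumr_ge0 => a _.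
by rewrite mulr_ge0 ?gen_fps_ge0.
Qed.

Lemma monom_eval_gen_gt0 n : exists m, [/\ #|` finsupp m| = mdeg n,
  forall u, u \in finsupp m -> (gen_index u < mdeg n)%N & 0 < monom_eval gen_fps n m].
Proof.
elim/cmonom_ind: n => [|v n [m [cm sm Pm]]].
  exists 1%M; rewrite mdom1 cardfs0 mdeg1 mmorph1 fps1E eqxx; split=> //.
(* By the bound on [gen_index], [m] uses only indices below [mdeg n], so [mdeg n] gives a fresh
   variable. *)
set x := alphabet v (mdeg n); set a := expcmn (ucm x) (gen_index v).+1.
have xm : x \notin finsupp m.
  by apply/negP => /sm; rewrite /x; case: (v) => k /=; rewrite ltnn.
exists (a * m)%M; rewrite mdomD finsupp_exp cardfsU1 xm cm mdegM mdegU; split=> //.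
  move=> u; rewrite !inE => /orP[/eqP->|/sm/ltnW//].
  by rewrite /x; case: (v) => k /=.
have aD : a \in mdivs (a * m)%M by apply: mem_mdivsP.
rewrite mmorphM /= monom_evalU fps_mulE (big_fsetD1 _ aD) gen_fps_power mul1r.
rewrite (divcmK (erefl _)) ltr_pwDl //.
apply: sumr_ge0 => b _.
by rewrite mulr_ge0 ?gen_fps_ge0 ?monom_eval_gen_ge0.
Qed.
End Independence.

(** * The algebra Lambda(X, Y) *)

Local Notation poly := {malg rat[{cmonom bivar}]}.

Lemma ps_eval_is_linear : linear ps_eval.
Proof.
move=> c q r; rewrite -[ps_eval]/(mmap (in_alg Lambda) (monom_eval ps_gen)).
by rewrite mmapD mmapZ mulr_algl.
Qed.
HB.instance Definition _ :=
  GRing.isLinear.Build rat poly Lambda _ ps_eval ps_eval_is_linear.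

Lemma ps_eval_monoid_morphism : monoid_morphism ps_eval.
Proof.
rewrite -[ps_eval]/(mmap (in_alg Lambda) (monom_eval ps_gen)).
by split=> [|q r]; [apply: rmorph1 | apply: rmorphM].
Qed.
HB.instance Definition _ :=
  GRing.isMonoidMorphism.Build poly Lambda ps_eval ps_eval_monoid_morphism.

Lemma ps_eval_var v : ps_eval << ucm v >> = ps_gen v.
Proof.
rewrite -[ps_eval]/(mmap (in_alg Lambda) (monom_eval ps_gen)).
by rewrite mmapU /= scale1r mul1r monom_evalU.
Qed.

Lemma lam_val_ps_eval q m : lam_val (ps_eval q) m =
  \sum_(n <- msupp q) q@_n * monom_eval gen_fps n m.
Proof.
have valE n : \val (monom_eval ps_gen n) = monom_eval gen_fps n.
  rewrite /monom_eval rmorph_prod; apply: eq_bigr => v _.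
  by rewrite rmorphXn; congr (_ ^+ _); case: v.
rewrite /ps_eval mmapE -[lam_val _]/(\val _) raddf_sum /=.
rewrite (big_morph (fun f : fps bivar rat => f m) (fun f g => fpsDE f g m) (erefl 0)).
by apply: eq_bigr => n _; rewrite mulr_algl -valE -fpsZE; congr (_ m).
Qed.

Lemma ps_eval_inj : injective ps_eval.
Proof.
apply: raddf_inj => q q0; apply/eqP; rewrite -msupp_eq0.
apply: contraPT q0 => /fset0Pn[n0 n0q].
(* Take [n] of maximal degree in [q] and a monomial [m] with [mdeg n] variables. A term [k] visible
   at [m] has degree at least [mdeg n], hence equal, and then [exponent_monom m] is both [k] and
   [n]. So the coefficient at [m] is [q@_n] times a positive number. *)
have [[n nq] _ /= nmax] := arg_maxnP (fun n : msupp q => mdeg (val n))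
  (isT : xpredT (FSetSub n0q)).
have [m [cm _ Pm]] := monom_eval_gen_gt0 n => q0.
have := lam_val_ps_eval q m; rewrite q0 (big_fsetD1 n nq) /=.
rewrite big1_fset => [|k]; last first.
  rewrite in_fsetD1 => /andP[kn kq] _.
  have [->|/monom_eval_gen_neq0[le_m eq_m]] := eqVneq (monom_eval gen_fps k m) 0.
    by rewrite mulr0.
  have kn_deg : mdeg k = mdeg n.
    by apply/eqP; rewrite eqn_leq (nmax (FSetSub kq)) // -cm.
  have [_ eq_n] : (#|` finsupp m| <= mdeg n)%N /\
      (#|` finsupp m| = mdeg n -> exponent_monom m = n).
    by apply: monom_eval_gen_neq0; rewrite gt_eqF.
  by case/eqP: kn; rewrite -eq_m ?kn_deg // eq_n.
move/esym/eqP; rewrite addr0 mulf_eq0 mcoeff_eq0 nq /=.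
by rewrite gt_eqF.
Qed.

(** Injectivity makes the polynomial chosen in [lam_deriv] equal to [q]. *)
Lemma lam_deriv_ps_eval v q : lam_deriv v (ps_eval q) = ps_eval (mp_deriv v q).
Proof.
rewrite /lam_deriv; case: xgetP => [r _ /= /ps_eval_inj -> //|/(_ q)] /=.
by case.
Qed.

(** * Transport along algebra morphisms *)

Section Transport.
Context (A B : comAlgType rat) (E : {lrmorphism A -> B}).

Lemma laguerre_morph n a t : E (laguerre n a t) = laguerre n a (E t).
Proof.
rewrite /laguerre linear_sum; apply: eq_bigr => k _.
by rewrite linearZ /= rmorphXn rmorphN.
Qed.

Lemma BD_factor_morph (p pt : nat -> A) k a b :
  E (BD_factor p pt k a b) = BD_factor (E \o p) (E \o pt) k a b.
Proof.
have tE : E (- (k%:R^-1 *: (p k * pt k))) = - (k%:R^-1 *: (E (p k) * E (pt k))).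
  by rewrite rmorphN /= linearZ /= rmorphM.
by rewrite /BD_factor; case: ifP => _; rewrite 2!(rmorphM E) (rmorph_nat E)
  (rmorphXn E) /= laguerre_morph tE.
Qed.

Lemma BD_morph (p pt : nat -> A) la mu :
  E (BD p pt la mu) = BD (E \o p) (E \o pt) la mu.
Proof.
rewrite /BD linearZ linear_sum; congr (_ *: _); apply: eq_bigr => s _.
rewrite linearZ linear_sum; congr (_ *: _); apply: eq_bigr => t _.
rewrite linearZ; congr (_ *: _); rewrite /= (rmorph_prod E).
by apply: eq_bigr => k _; rewrite /= BD_factor_morph.
Qed.

(** Truncations are finite combinations of composed derivatives, so [E] commutes with them once it
    intertwines the derivatives. These are plain functions, since [lam_deriv] is defined through a
    choice. *)
Lemma Delta_trunc_morph (d dt : nat -> A -> A) (d' dt' : nat -> B -> B) N M f :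
  (forall k x, d' k (E x) = E (d k x)) -> (forall k x, dt' k (E x) = E (dt k x)) ->
  Delta_trunc d' dt' N M (E f) = E (Delta_trunc d dt N M f).
Proof.
move=> dE dtE; rewrite /Delta_trunc.
apply: (big_ind2 (fun F G => forall x, F (E x) = E (G x))) f => //.
  by move=> F1 G1 F2 G2 FG1 FG2 x; rewrite /= FG2 FG1.
move=> k _ x; rewrite /Delta_factor linear_sum; apply: eq_bigr => i _.
rewrite linearZ /=; congr (_ *: _).
by elim: i => [|i IH] //=; rewrite IH dtE dE.
Qed.
End Transport.

(** Agreement is asked at positive indices because [psX 0] differs from the image of [poly_p 0],
    which is [psX 1]. *)
Lemma BD_eq (A : comAlgType rat) (p pt p' pt' : nat -> A) la mu :
  (forall k, (0 < k)%N -> p k = p' k) -> (forall k, (0 < k)%N -> pt k = pt' k) ->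
  BD p pt la mu = BD p' pt' la mu.
Proof.
move=> pE ptE; congr (_ *: _); apply: eq_bigr => s _; congr (_ *: _).
apply: eq_bigr => t _; congr (_ *: _); apply: eq_big_nat => k /andP[k0 _].
by rewrite /BD_factor pE ?ptE.
Qed.

Definition poly_p (k : nat) : poly := << ucm (inl k.-1 : bivar) >>.
Definition poly_pt (k : nat) : poly := << ucm (inr k.-1 : bivar) >>.

Lemma BD_Lambda_ps_eval la mu : BD_Lambda la mu = ps_eval (BD poly_p poly_pt la mu).
Proof.
by rewrite BD_morph; apply: BD_eq => -[] //= k _; rewrite ps_eval_var.
Qed.

Lemma Delta_BD_Lambda la mu :
  Delta_Lambda (BD_Lambda la empty_part * BD_Lambda empty_part mu) = BD_Lambda la mu.
Proof.
pose d k : {linear poly -> poly} := mp_deriv (inl k.-1).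
pose dt k : {linear poly -> poly} := mp_deriv (inr k.-1).
apply: (@DeltaE _ _ _ _ _ (sumn la + sumn mu).+1) => N M nN nM.
(* All terms are values of [ps_eval], so the truncations can be computed on polynomials. *)
rewrite !BD_Lambda_ps_eval -rmorphM.
rewrite (Delta_trunc_morph (d := d) (dt := dt)) => [|k x|k x]; last 2 first.
- exact: lam_deriv_ps_eval.
- exact: lam_deriv_ps_eval.
congr ps_eval; apply: Delta_trunc_BD nN nM => [k|k|[|k] [|l] //|k l|k l|[|k] [|l] //];
  by do ?[exact: mp_derivM]; rewrite /= /poly_p /poly_pt mp_deriv_var.
Qed.

Theorem theorem2 (la mu : intpart) :
  Delta_V (BD_V la empty_part * BD_V empty_part mu) = BD_V la mu /\
  Delta_Lambda (BD_Lambda la empty_part * BD_Lambda empty_part mu) =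
    BD_Lambda la mu.
Proof. by split; [apply: Delta_BD_V | apply: Delta_BD_Lambda]. Qed.
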